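(* Let $R$ be a (not-necessarily-commutative) ring, and let $A=(a_{ij})$ and $B=(b_{ij})$ be $n\times n$ matrices with elements in $R$. Suppose that for all $i,j,k,l\in[n]$ $$[a_{ij},a_{kl}]=0,\qquad [a_{ij},b_{kl}]=-\delta_{ik}h_{jl},\qquad [a_{ij},h_{kl}]=0,$$ where $H=(h_{jl})_{j,l=1}^n$ is a matrix with elements in $R$. Then, for any $I,J\subseteq[n]$ of cardinality $|I|=|J|=r$ (with $1\le r\le n$), writing $I=\{i_1<\dots<i_r\}$ and $J=\{j_1<\dots<j_r\}$, and any nonnegative integer $s$, we have $$\sum_{L\subseteq[n],\,|L|=r}\bigl(\det\,(A^{\mathrm T})_{IL}\bigr)\bigl(\text{col-det}\,B_{LJ}\bigr)(\det A)^s=(\det A)^s\,\text{col-det}\bigl[(A^{\mathrm T}B+sH)_{IJ}+Q_{\rm col}\bigr],$$ where $(Q_{\rm col})_{\alpha\beta}=(r-\beta)\,h_{i_\alpha j_\beta}$ for $1\le\alpha,\beta\le r$.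
   Context: Notation: $[n]=\{1,\dots,n\}$; $[x,y]=xy-yx$; $M_{IJ}$ is the submatrix of $M$ with rows $I$ and columns $J$ kept in their original (increasing) order. $\delta_{ik}h_{jl}$ means $h_{jl}$ if $i=k$ and $0$ otherwise. When $s=0$ the factors $(\det A)^s$ are equal to the identity (i.e. are omitted). For an $r\times r$ matrix $M$ over a ring, $\text{col-det}\,M=\sum_{\sigma\in\mathcal S_r}\mathrm{sgn}(\sigma)\,M_{\sigma(1)1}M_{\sigma(2)2}\cdots M_{\sigma(r)r}$; $\det$ is the usual determinant, used for matrices with commuting entries. *)

(* Defs.v *)
From mathcomp Require Import all_boot all_fingroup all_algebra.
Set Implicit Arguments.
Unset Strict Implicit.
Unset Printing Implicit Defensive.
Import GRing.Theory.
Local Open Scope ring_scope.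

Definition ring_comm (R : pzRingType) (x y : R) : R := x * y - y * x.

(* The product over 'I_r is taken in increasing order of the column index, so
   the order of the factors is meaningful over a noncommutative ring. *)
Definition col_det (R : pzRingType) (r : nat) (M : 'M[R]_r) : R :=
  \sum_(s : 'S_r) (-1) ^+ s * \prod_(c < r) M (s c) c.

(* The increasing enumeration i_1 < ... < i_r of I, indexed from 0. *)
Definition elt (n r : nat) (I : {set 'I_n}) (hI : #|I| = r) (a : 'I_r) : 'I_n :=
  enum_val (cast_ord (esym hI) a).

Definition rsubset (n r : nat) := {L : {set 'I_n} | #|L| == r}.

Definition rsubset_card (n r : nat) (L : rsubset n r) : #|val L| = r :=
  eqP (valP L).

Definition submx_of (R : Type) (n r : nat) (M : 'M[R]_n) (I J : {set 'I_n})
    (hI : #|I| = r) (hJ : #|J| = r) : 'M[R]_r :=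
  mxsub (elt hI) (elt hJ) M.

(* The coefficient is r - beta for the 1-based column index beta = b + 1. *)
Definition Q_col (R : pzRingType) (n r : nat) (H : 'M[R]_n) (I J : {set 'I_n})
    (hI : #|I| = r) (hJ : #|J| = r) : 'M[R]_r :=
  \matrix_(a < r, b < r) (H (elt hI a) (elt hJ b) *+ (r - b.+1)).

Lemma elt_mem n r (I : {set 'I_n}) (hI : #|I| = r) a : elt hI a \in I.
Proof. exact: enum_valP. Qed.

Lemma elt_lt n r (I : {set 'I_n}) (hI : #|I| = r) (a b : 'I_r) :
  (a < b)%N -> (elt hI a < elt hI b)%N.
Proof.
move=> lt_ab; rewrite /elt /enum_val.
set x := cast_ord _ a; set y := cast_ord _ b.
have srt : sorted (fun i j : 'I_n => (i < j)%N) (enum I).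
  rewrite {1}/enum_mem -enumT; apply: sorted_filter.
    by move=> i j k; apply: ltn_trans.
  have := iota_ltn_sorted 0 n.
  by rewrite -val_enum_ord sorted_map.
rewrite (set_nth_default (enum_default x) (enum_default y)) -?cardE //.
apply: (sorted_ltn_nth _ _ srt) => //; first by move=> i j k; apply: ltn_trans.
- by rewrite inE -cardE.
- by rewrite inE -cardE.
Qed.

(* Main.v *)
Require Import Defs.
From HB Require Import structures.
From mathcomp Require Import all_boot all_fingroup all_algebra boolp.
Set Implicit Arguments.
Unset Strict Implicit.
Unset Printing Implicit Defensive.
Import GRing.Theory.
Local Open Scope ring_scope.

(** The parameter s is absorbed first.  Put D = \det A and C = A^T *m B.  Since
    B k l fails to commute only with row k of A, Laplace expansion of D along
    that row gives B k l * D = D * B k l + \sum_j H j l * cofactor A k j, and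
    multiplying by A k i and summing over k turns this into
    C i l * D = D * (C i l + H i l) (lemma ATB_det).  Hence moving D ^+ s from
    the right to the left of a column determinant in the entries of C replaces
    C by C + H *+ s (ATB_detX, col_det_conj), and only the Capelli identity,
    s = 0, is left.

    For s = 0, expand both determinants on the left.  The minors of A kill the
    maps l from columns to rows that are not injective, and the injective ones
    are pairs of a subset L and a permutation, so the left-hand side is the
    alternating sum over w in 'S_r of
      \sum_l (\prod_b A (l b) (i (w b))) * \prod_b B (l b) (j b)
    (sum_minors).  This inner sum is obtained from 1 by applying, for each
    column b in turn, the map P |-> \sum_l A l u * P * B l v with u = i (w b)
    and v = j b (nested_expand).  The first column produces an entry C u v,
    which has to be pulled out through all the later maps; each of them yields
    a correction in which two row indices have been exchanged
    (sandwich_ATB, nested_ATB).  Under the alternating sum the exchange is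
    undone at the price of a sign, so every later column contributes the same
    term H u v: the first factor becomes C u v plus H u v times the number of
    remaining columns (alternating_step).  Iterating over the columns gives the
    column determinant with the correction r - b.+1 in column b (capelli).

    Determinants of matrices with pairwise commuting entries are handled by
    lifting the matrix along a ring morphism from a commutative ring
    (commuting_matrix_lift). *)

(** * Commuting elements lie in a commutative subring *)

Section Bicommutant.
Variables (R : pzRingType) (S : R -> Prop).
Hypothesis commS : forall x y, S x -> S y -> GRing.comm x y.

(** Unlike the commutant of S, its double commutant is commutative as soon as
    the elements of S commute, and it contains them. *)
Definition bicommutant : {pred R} :=
  [pred x | `[< forall y,
     (forall z, S z -> GRing.comm y z) -> GRing.comm x y >]].

Lemma bicommutantP x :
  reflect (forall y, (forall z, S z -> GRing.comm y z) -> GRing.comm x y)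
          (x \in bicommutant).
Proof. exact: asboolP. Qed.

Lemma bicommutant_subring : subring_closed bicommutant.
Proof.
split=> [|x z /bicommutantP xP /bicommutantP zP
         |x z /bicommutantP xP /bicommutantP zP];
  apply/bicommutantP => y Sy; apply/commr_sym.
- exact: commr1.
- by apply: commrB; apply/commr_sym; [apply: xP | apply: zP].
- by apply: commrM; apply/commr_sym; [apply: xP | apply: zP].
Qed.
HB.instance Definition _ :=
  GRing.isSubringClosed.Build R bicommutant bicommutant_subring.

Record bicomm := Bicomm { bicomm_val : R; _ : bicomm_val \in bicommutant }.
HB.instance Definition _ := [isSub for bicomm_val].
HB.instance Definition _ := [Choice of bicomm by <:].
HB.instance Definition _ :=
  GRing.SubChoice_isSubPzRing.Build R bicommutant bicomm
    (GRing.subringClosedP bicommutant).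

Lemma mem_bicommutant x : S x -> x \in bicommutant.
Proof. by move=> Sx; apply/bicommutantP => y Sy; apply/commr_sym/Sy. Qed.

Lemma bicomm_mulC : commutative (@GRing.mul bicomm).
Proof.
move=> x y; apply: val_inj; rewrite !rmorphM.
have /bicommutantP xP := valP x; have /bicommutantP yP := valP y.
by apply: xP => z Sz; apply: yP => w Sw; apply: commS.
Qed.

Lemma comm_lift m n (M : 'M[R]_(m, n)) :
  (forall i j, S (M i j)) ->
  exists (C : comPzRingType) (f : {rmorphism C -> R}) (M0 : 'M[C]_(m, n)),
    M = map_mx f M0.
Proof.
move=> SM.
pose C : comPzRingType := HB.pack bicomm
  (GRing.PzRing_hasCommutativeMul.Build bicomm bicomm_mulC).
exists C, (\val : {rmorphism bicomm -> R}).
exists (\matrix_(i, j) (Bicomm (mem_bicommutant (SM i j)) : C)).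
by apply/matrixP=> i j; rewrite !mxE.
Qed.
End Bicommutant.

(** * Determinants over a noncommutative ring *)

Section CommDet.
Variable R : pzRingType.

(** Identities between determinants, minors and cofactors of a matrix with
    commuting entries follow from the commutative case by applying f. *)
Lemma commuting_matrix_lift m n (M : 'M[R]_(m, n)) :
  (forall i j k l, GRing.comm (M i j) (M k l)) ->
  exists (C : comPzRingType) (f : {rmorphism C -> R}) (M0 : 'M[C]_(m, n)),
    M = map_mx f M0.
Proof.
move=> commM; apply: (@comm_lift _ (fun x => exists i j, x = M i j)).
  by move=> _ _ [i [j ->]] [k [l ->]].
by move=> i j; exists i, j.
Qed.

Lemma comm_det x n (M : 'M[R]_n) :
  (forall i j, GRing.comm x (M i j)) -> GRing.comm x (\det M).
Proof.
move=> xM; rewrite /determinant; apply: commr_sum => s _.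
by apply: commrM; [apply: commr_sign | apply: commr_prod].
Qed.

(** The element d crosses the factors of each product one at a time, which
    keeps their order. *)
Lemma col_det_conj r (M M' : 'M[R]_r) d :
  (forall i j, M i j * d = d * M' i j) -> col_det M * d = d * col_det M'.
Proof.
move=> MM'; rewrite /col_det mulr_suml mulr_sumr; apply: eq_bigr => s _.
rewrite [RHS]mulrA (commr_sign d) -!mulrA; congr (_ * _).
elim: (index_enum _) => [|c t IHt]; first by rewrite !big_nil mulr1 mul1r.
by rewrite !big_cons -mulrA IHt !mulrA MM'.
Qed.
End CommDet.

(** * Injective maps as subsets with a permutation *)

Section Subset.
Variables (n r : nat).
Lemma elt_inj (L : {set 'I_n}) (hL : #|L| = r) : injective (elt hL).
Proof. by move=> a b /enum_val_inj /cast_ord_inj. Qed.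

Lemma imset_elt (L : {set 'I_n}) (hL : #|L| = r) :
  [set elt hL a | a : 'I_r] = L.
Proof.
apply/eqP; rewrite eqEcard card_imset ?card_ord ?hL ?leqnn ?andbT; last first.
  exact: elt_inj.
by apply/subsetP => _ /imsetP[a _ ->]; apply: elt_mem.
Qed.

Lemma sum_injective (V : nmodType) (F : {ffun 'I_r -> 'I_n} -> V) :
  \sum_(l : {ffun 'I_r -> 'I_n} | injectiveb l) F l =
  \sum_(L : rsubset n r) \sum_(t : 'S_r) F [ffun b => elt (rsubset_card L) (t b)].
Proof.
pose h (p : rsubset n r * 'S_r) := [ffun b => elt (rsubset_card p.1) (p.2 b)].
have h_inj : injective h.
  move=> [L t] [L' t'] /ffunP eq_h.
  have eqE b : elt (rsubset_card L) (t b) = elt (rsubset_card L') (t' b).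
    by have := eq_h b; rewrite !ffunE.
  have eqL : L = L'.
    apply: val_inj; rewrite -(imset_elt (rsubset_card L)).
    rewrite -(imset_elt (rsubset_card L')).
    apply/setP=> x; apply/imsetP/imsetP => -[a _ ->].
      by exists (t' (t^-1 a)%g); rewrite // -eqE permKV.
    by exists (t (t'^-1 a)%g); rewrite // eqE permKV.
  move: eqE; rewrite -eqL => eqE; congr (_, _).
  by apply/permP=> b; apply/(elt_inj (eqE b)).
have -> : (\sum_(l : {ffun 'I_r -> 'I_n} | injectiveb l) F l) =
          \sum_(l in h @: setT) F l.
  apply: eq_bigl => l; apply/injectiveP/imsetP => [l_inj|[[L t] _ ->]]; last first.
    by move=> a b; rewrite !ffunE => /elt_inj/perm_inj.
  (* An injective l is recovered from its image L and the rank in L of each of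
     its values. *)
  have cardL : #|[set l b | b : 'I_r]| == r by rewrite card_imset ?card_ord.
  pose L : rsubset n r := Sub [set l b | b : 'I_r] cardL.
  have elt_l b : exists a, elt (rsubset_card L) a == l b.
    have: l b \in [set elt (rsubset_card L) a | a : 'I_r].
      by rewrite imset_elt; apply: imset_f.
    by case/imsetP=> a _ ->; exists a.
  pose t b := xchoose (elt_l b).
  have tE b : elt (rsubset_card L) (t b) = l b by apply/eqP/(xchooseP (elt_l b)).
  have t_inj : injective t by move=> a b eq_t; apply: l_inj; rewrite -!tE eq_t.
  by exists (L, perm t_inj) => //; apply/ffunP=> b; rewrite ffunE permE tE.
rewrite big_imset /=; last by move=> p q _ _; apply: h_inj.
rewrite [RHS]pair_bigA /=; apply: eq_bigl => p; exact: in_setT.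
Qed.
End Subset.

(** * Minors of a matrix with commuting entries *)

Section Minors.
Variables (R : pzRingType) (n : nat) (A : 'M[R]_n).
Hypothesis AA : forall i j k l, GRing.comm (A i j) (A k l).
Variables (r : nat) (i : 'I_r -> 'I_n).

Lemma minor_noninj (l : 'I_r -> 'I_n) : ~~ injectiveb l -> \det (mxsub l i A) = 0.
Proof.
have [C [f [A0 ->]]] := commuting_matrix_lift AA; rewrite -map_mxsub det_map_mx.
case/injectivePn=> a [b ab eq_l]; rewrite (determinant_alternate ab) ?rmorph0 //.
by move=> c; rewrite !mxE eq_l.
Qed.

Lemma minor_perm (l : 'I_r -> 'I_n) (t : 'S_r) :
  \det (mxsub (l \o t) i A) = (-1) ^+ t * \det (mxsub l i A).
Proof.
have [C [f [A0 ->]]] := commuting_matrix_lift AA; rewrite -!map_mxsub !det_map_mx.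
rewrite -(rmorph_sign f) -rmorphM; congr (f _).
rewrite -det_perm -det_mulmx -row_permE; congr (\det _).
by apply/matrixP=> a b; rewrite !mxE.
Qed.

Lemma minor_tr (l : 'I_r -> 'I_n) : \det (mxsub i l A^T) = \det (mxsub l i A).
Proof.
have [C [f [A0 ->]]] := commuting_matrix_lift AA.
have -> : mxsub i l (map_mx f A0)^T = map_mx f (mxsub l i A0)^T.
  by apply/matrixP=> a b; rewrite !mxE.
by rewrite -map_mxsub !det_map_mx det_tr.
Qed.
End Minors.


(** * The Capelli identity *)

Section Capelli.
Variables (R : pzRingType) (n : nat) (A B H : 'M[R]_n).
Hypothesis AA : forall i j k l, GRing.comm (A i j) (A k l).
Hypothesis AB : forall i j k l,
  A i j * B k l = B k l * A i j - (if i == k then H j l else 0).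
Hypothesis AH : forall i j k l, GRing.comm (A i j) (H k l).

Definition sandwich (u v : 'I_n) (P : R) : R := \sum_l A l u * P * B l v.

(** The first column of t is innermost, so the entries of B come out in the
    order of t and those of A in the reverse order. *)
Definition nested (T : Type) (i j : T -> 'I_n) (t : seq T) (P : R) : R :=
  foldl (fun P b => sandwich (i b) (j b) P) P t.

Lemma nested_cons T (i j : T -> 'I_n) b t P :
  nested i j (b :: t) P = nested i j t (sandwich (i b) (j b) P).
Proof. by []. Qed.

Lemma nested_map T T' (f : T -> T') (i j : T' -> 'I_n) t P :
  nested i j (map f t) P = nested (i \o f) (j \o f) t P.
Proof. by elim: t P => //= b t IHt P; rewrite !nested_cons IHt. Qed.

(** Since the entries of A commute, their reversed product may be taken in the
    order of the columns. *)
Lemma nested_expand r (i j : 'I_r -> 'I_n) P :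
  nested i j (enum 'I_r) P =
  \sum_(l : {ffun 'I_r -> 'I_n})
     \prod_b A (l b) (i b) * P * \prod_b B (l b) (j b).
Proof.
elim: r i j P => [|r IHr] i j P.
  rewrite enum_ord0 /= (big_pred1 (ffun0 (card_ord 0) : {ffun _ -> _})).
    by rewrite !big_ord0 mul1r mulr1.
  by move=> l; apply/esym/eqP/ffunP; case.
rewrite enum_ordSl nested_cons nested_map IHr.
pose h (p : 'I_n * {ffun 'I_r -> 'I_n}) : {ffun 'I_r.+1 -> 'I_n} :=
  [ffun b => if unlift ord0 b is Some c then p.2 c else p.1].
pose h' (l : {ffun 'I_r.+1 -> 'I_n}) := (l ord0, [ffun c => l (lift ord0 c)]).
rewrite [RHS](reindex h) /=; last first.
  exists h' => [[x g] _|l _].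
    rewrite /h' /h; congr (_, _); first by rewrite ffunE unlift_none.
    by apply/ffunP=> c; rewrite !ffunE liftK.
  by apply/ffunP=> b; rewrite ffunE; case: unliftP => [c|] -> //=; rewrite ffunE.
rewrite -(pair_bigA _ (fun x g => \prod_b A (h (x, g) b) (i b) * P *
                                  \prod_b B (h (x, g) b) (j b))) exchange_big.
apply: eq_bigr => g _; rewrite /sandwich mulr_sumr mulr_suml.
apply: eq_bigr => x _; rewrite !big_ord_recl /=.
have h0 : h (x, g) ord0 = x by rewrite ffunE unlift_none.
have hS c : h (x, g) (lift ord0 c) = g c by rewrite ffunE liftK.
rewrite h0; under [in RHS]eq_bigr do rewrite hS.
under [X in _ = _ * (_ * X)]eq_bigr do rewrite hS.
rewrite !mulrA; congr (_ * _ * _ * _).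
by apply/commr_sym/commr_prod.
Qed.

Notation ATB := (A^T *m B).

Lemma commA_ATB l u v j : A l u * ATB v j = ATB v j * A l u - A l v * H u j.
Proof.
rewrite mxE mulr_sumr mulr_suml.
have -> : A l v * H u j = \sum_k A^T v k * (if l == k then H u j else 0).
  rewrite (bigD1 l) //= eqxx mxE big1 ?addr0 // => k /negPf lk.
  by rewrite eq_sym lk mulr0.
rewrite -sumrB; apply: eq_bigr => k _.
by rewrite mxE mulrA (AA l u) -mulrA AB mulrBr mulrA.
Qed.

(** The correction exchanges the row indices u and v: v goes into the sandwich
    and u into the entry of H that comes out. *)
Lemma sandwich_ATB u j' v j P :
  sandwich u j' (ATB v j * P) = ATB v j * sandwich u j' P - H u j * sandwich v j' P.
Proof.
rewrite /sandwich !mulr_sumr -sumrB; apply: eq_bigr => l _.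
by rewrite !mulrA commA_ATB (AH l v) !mulrBl.
Qed.

Lemma sandwichB u v P Q : sandwich u v (P - Q) = sandwich u v P - sandwich u v Q.
Proof. by rewrite -sumrB; apply: eq_bigr => l _; rewrite mulrBr mulrBl. Qed.

Lemma sandwich_H u v k l P : sandwich u v (H k l * P) = H k l * sandwich u v P.
Proof. by rewrite mulr_sumr; apply: eq_bigr => m _; rewrite !mulrA AH. Qed.

Lemma nestedB T (i j : T -> 'I_n) t P Q :
  nested i j t (P - Q) = nested i j t P - nested i j t Q.
Proof. by elim: t P Q => //= b t IHt P Q; rewrite sandwichB IHt. Qed.

Lemma nested_H T (i j : T -> 'I_n) t k l P :
  nested i j t (H k l * P) = H k l * nested i j t P.
Proof. by elim: t P => //= b t IHt P; rewrite sandwich_H IHt. Qed.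

Lemma eq_nested (T : eqType) (i i' j : T -> 'I_n) t P :
  {in t, i =1 i'} -> nested i j t P = nested i' j t P.
Proof.
elim: t P => //= b t IHt P ii'; rewrite ii' ?mem_head // IHt // => c ct.
by rewrite ii' // inE ct orbT.
Qed.

(** Pulling an entry of A^T *m B out of all the layers: the layer g contributes
    the term where its row index i g has been traded for v.  Entries of H
    commute with A, so they come out without further correction. *)
Lemma nested_ATB (T : eqType) (i j : T -> 'I_n) t v k P : uniq t ->
  nested i j t (ATB v k * P) =
  ATB v k * nested i j t P
  - \sum_(g <- t) H (i g) k * nested [eta i with g |-> v] j t P.
Proof.
elim: t P => [|b t IHt] P /=; first by rewrite big_nil subr0.
case/andP=> bt t_uniq; rewrite sandwich_ATB nestedB nested_H IHt // big_cons eqxx.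
rewrite -addrA -opprD [X in _ - X]addrC; congr (_ - (_ * _ + _)).
  by apply: eq_nested => c ct /=; case: eqP bt => // <-; rewrite ct.
apply: eq_big_seq => g gt.
by case: eqP bt => // ->; rewrite gt.
Qed.

(** Evaluating the layer m.  In the correction coming from g in t, the row
    indices s m and s g are exchanged, which composing s with tperm m g undoes
    at the price of a sign; so each of the size t corrections contributes the
    same entry of H, with a plus sign.  The prefactor pre stands for the columns
    already evaluated, which the transpositions leave alone. *)
Lemma alternating_step r (i j : 'I_r -> 'I_n) (pre : 'S_r -> R) m t :
  uniq (m :: t) ->
  (forall g s, g \in t -> pre (tperm m g * s)%g = pre s) ->
  \sum_(s : 'S_r) (-1) ^+ s * (pre s * nested (i \o s) j (m :: t) 1) =
  \sum_(s : 'S_r) (-1) ^+ s *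
    (pre s * (ATB (i (s m)) (j m) + H (i (s m)) (j m) *+ size t) *
     nested (i \o s) j t 1).
Proof.
case/andP=> mt t_uniq preE.
have step (s : 'S_r) : nested (i \o s) j (m :: t) 1 =
   ATB (i (s m)) (j m) * nested (i \o s) j t 1 -
   \sum_(g <- t) H (i (s g)) (j m) * nested (i \o (tperm m g * s)%g) j t 1.
  rewrite [LHS]/= [sandwich _ _ _](_ : _ = ATB (i (s m)) (j m) * 1); last first.
    by rewrite mulr1 mxE; apply: eq_bigr => l _; rewrite mxE mulr1.
  rewrite nested_ATB //; congr (_ - _); apply: eq_big_seq => g gt.
  congr (_ * _); apply: eq_nested => c ct /=.
  rewrite permM; case: eqP => [->|/eqP cg]; first by rewrite tpermR.
  by rewrite tpermD // eq_sym //; apply: contraNneq mt => <-.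
under eq_bigr do rewrite step !mulrBr.
under [RHS]eq_bigr do rewrite mulrDr mulrDl mulrDr -mulrA.
rewrite sumrB big_split /=; congr (_ + _).
under eq_bigr do rewrite !mulr_sumr.
rewrite exchange_big /= -sumrN.
under [RHS]eq_bigr do rewrite !mulrnAr mulrnAl mulrnAr.
rewrite sumrMnl; set K := \sum_(s : 'S_r) _.
have -> : K *+ size t = \sum_(g <- t) K by rewrite big_const_seq count_predT iter_addr_0.
apply: eq_big_seq => g gt.
rewrite -sumrN /K (reindex_inj (mulgI (tperm m g))) /=; apply: eq_bigr => s _.
have mg : m != g by apply: contraNneq mt => ->.
rewrite odd_permM odd_tperm mg signr_addb expr1 mulN1r mulNr opprK preE //.
by rewrite mulgA tperm2 mul1g permM tpermR !mulrA.
Qed.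

(** The columns in p have been evaluated and those in t have not; when m is the
    next column, r - m.+1 columns remain after it. *)
Lemma col_expansion r (i j : 'I_r -> 'I_n) p t : p ++ t = enum 'I_r ->
  let M : 'S_r -> 'I_r -> R :=
    fun s c => ATB (i (s c)) (j c) + H (i (s c)) (j c) *+ (r - c.+1) in
  \sum_(s : 'S_r) (-1) ^+ s * (\prod_(c <- p) M s c * nested (i \o s) j t 1) =
  \sum_(s : 'S_r) (-1) ^+ s * \prod_(c <- enum 'I_r) M s c.
Proof.
move=> + M; elim: t p => [|m t IHt] p pt.
  by apply: eq_bigr => s _; rewrite mulr1 -pt cats0.
have : uniq (p ++ m :: t) by rewrite pt enum_uniq.
rewrite cat_uniq => /and3P[_ /hasPn pmt mt_uniq].
have size_p : size p = m.
  have : index m (p ++ m :: t) = m by rewrite pt index_enum_ord.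
  rewrite index_cat ifN; last by apply: pmt; rewrite mem_head.
  by rewrite /= eqxx addn0.
have size_t : size t = (r - m.+1)%N.
  have : size (p ++ m :: t) = r by rewrite pt size_enum_ord.
  rewrite size_cat /= size_p => /(congr1 (subn^~ m.+1)) <-.
  by rewrite addnS -addSn addKn.
rewrite alternating_step // => [|g s gt].
  rewrite -(IHt (rcons p m)) ?cat_rcons //; apply: eq_bigr => s _.
  by rewrite size_t -cats1 big_cat big_seq1.
apply: eq_big_seq => c cp.
rewrite /M permM tpermD //; apply: contraTneq cp => <-; apply: pmt.
  exact: mem_head.
by rewrite inE gt orbT.
Qed.

Lemma capelli r (i j : 'I_r -> 'I_n) :
  \sum_(s : 'S_r) (-1) ^+ s * nested (i \o s) j (enum 'I_r) 1 =
  col_det (\matrix_(a < r, b < r) (ATB (i a) (j b) + H (i a) (j b) *+ (r - b.+1))).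
Proof.
transitivity (\sum_(s : 'S_r) (-1) ^+ s *
   (\prod_(c <- [::]) (ATB (i (s c)) (j c) + H (i (s c)) (j c) *+ (r - c.+1)) *
    nested (i \o s) j (enum 'I_r) 1)).
  by apply: eq_bigr => s _; rewrite big_nil mul1r.
rewrite col_expansion //; apply: eq_bigr => s _.
rewrite enumT; congr (_ * _); rewrite [index_enum _]unlock.
by apply: eq_bigr => c _; rewrite [RHS]mxE.
Qed.

(** Summing over s first yields the minor of A with rows l, which vanishes
    unless l is injective and is alternating in l; its sign is the one needed to
    assemble the column determinants of B. *)
Lemma sum_minors r (I J : {set 'I_n}) (hI : #|I| = r) (hJ : #|J| = r) :
  \sum_(L : rsubset n r)
     \det (submx_of A^T hI (rsubset_card L)) * col_det (submx_of B (rsubset_card L) hJ)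
  = \sum_(s : 'S_r) (-1) ^+ s * nested (elt hI \o s) (elt hJ) (enum 'I_r) 1.
Proof.
under [RHS]eq_bigr do rewrite nested_expand mulr_sumr.
rewrite exchange_big /=.
transitivity (\sum_(l : {ffun 'I_r -> 'I_n})
   \det (mxsub l (elt hI) A) * \prod_b B (l b) (elt hJ b)); last first.
  apply: eq_bigr => l _; rewrite mulr_suml; apply: eq_bigr => s _.
  rewrite mulr1 mulrA; congr (_ * _ * _).
  by apply: eq_bigr => b _; rewrite mxE.
rewrite (bigID (fun l : {ffun 'I_r -> 'I_n} => injectiveb l)) /= [X in _ + X]big1 ?addr0.
  rewrite sum_injective; apply: eq_bigr => L _.
  rewrite /submx_of minor_tr // mulr_sumr; apply: eq_bigr => t _.
  have -> : mxsub [ffun b => elt (rsubset_card L) (t b)] (elt hI) A =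
            mxsub (elt (rsubset_card L) \o t) (elt hI) A.
    by apply/matrixP=> a b; rewrite !mxE ffunE.
  rewrite minor_perm // mulrA (commr_sign _ t).
  by congr (_ * _ * _); apply: eq_bigr => b _; rewrite mxE ffunE.
by move=> l l_ninj; rewrite minor_noninj ?mul0r.
Qed.

(** * Moving the determinant of A to the left *)

Lemma comm_det_H k l : GRing.comm (\det A) (H k l).
Proof. by apply/commr_sym/comm_det => a b; apply/commr_sym. Qed.

(** Row k of A is the only one that does not commute with B k l, and this
    cofactor omits it. *)
Lemma comm_B_cofactor k l j : GRing.comm (B k l) (cofactor A k j).
Proof.
apply: commrM; first exact: commr_sign.
apply: comm_det => a b; rewrite !mxE /GRing.comm AB eq_sym (negPf (neq_lift _ _)).
by rewrite subr0.
Qed.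

Lemma comm_A_cofactor a b k j : GRing.comm (A a b) (cofactor A k j).
Proof.
apply: commrM; first exact: commr_sign.
by apply: comm_det => c d; rewrite !mxE.
Qed.

Lemma det_row_cofactor k : \det A = \sum_j A k j * cofactor A k j.
Proof.
have [C [f [A0 ->]]] := commuting_matrix_lift AA.
rewrite det_map_mx (expand_det_row _ k) rmorph_sum; apply: eq_bigr => j _.
by rewrite rmorphM cofactor_map_mx mxE.
Qed.

Lemma sum_A_cofactor i j :
  \sum_k A k i * cofactor A k j = if i == j then \det A else 0.
Proof.
under eq_bigr do rewrite comm_A_cofactor.
have [C [f [A0 ->]]] := commuting_matrix_lift AA.
have /matrixP/(_ j i) := mul_adj_mx A0; rewrite !mxE => /(congr1 f).
rewrite rmorph_sum rmorphMn eq_sym det_map_mx /= => eq_ji.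
transitivity (f (\det A0) *+ (i == j)); last by case: (i == j).
rewrite -eq_ji; apply: eq_bigr => k _.
by rewrite rmorphM cofactor_map_mx !mxE.
Qed.

(** Only the entry of row k in the Laplace expansion meets B k l nontrivially:
    the sum is the derivation B k l applied to the determinant. *)
Lemma B_det k l : B k l * \det A = \det A * B k l + \sum_j H j l * cofactor A k j.
Proof.
rewrite (det_row_cofactor k) mulr_sumr mulr_suml -big_split; apply: eq_bigr => j _ /=.
rewrite -mulrA -comm_B_cofactor; move: (cofactor A k j) => c.
by rewrite !mulrA AB eqxx mulrBl subrK.
Qed.

(** By Cramer's rule only j = i survives in the sum over k of A k i times the
    correction in B_det. *)
Lemma ATB_det i l : ATB i l * \det A = \det A * (ATB i l + H i l).
Proof.
rewrite mulrDr mxE mulr_suml mulr_sumr.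
under eq_bigr do rewrite mxE -mulrA B_det mulrDr.
rewrite big_split; congr (_ + _).
  apply: eq_bigr => k _; rewrite mxE !mulrA; congr (_ * _).
  exact: comm_det.
under eq_bigr do rewrite mulr_sumr.
rewrite exchange_big /=.
transitivity (\sum_j H j l * (if i == j then \det A else 0)).
  apply: eq_bigr => j _; rewrite -sum_A_cofactor mulr_sumr; apply: eq_bigr => k _.
  by rewrite !mulrA AH.
rewrite (bigD1 i) //= eqxx big1 ?addr0 ?comm_det_H // => j /negPf ij.
by rewrite eq_sym ij mulr0.
Qed.

Lemma ATB_detX s i l : ATB i l * \det A ^+ s = \det A ^+ s * (ATB i l + H i l *+ s).
Proof.
elim: s => [|s IHs]; first by rewrite mulr1 mul1r addr0.
rewrite exprSr mulrA IHs -!mulrA mulrDl ATB_det mulrnAl -comm_det_H -mulrnAr -mulrDr.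
by rewrite -addrA mulrS.
Qed.
End Capelli.

Theorem propositionA1 (R : pzRingType) (n : nat) (A B H : 'M[R]_n)
  (hAA : forall i j k l : 'I_n, ring_comm (A i j) (A k l) = 0)
  (hAB : forall i j k l : 'I_n,
     ring_comm (A i j) (B k l) = - (if i == k then H j l else 0))
  (hAH : forall i j k l : 'I_n, ring_comm (A i j) (H k l) = 0)
  (r : nat) (hr : (1 <= r <= n)%N)
  (I J : {set 'I_n}) (hI : #|I| = r) (hJ : #|J| = r) (s : nat) :
  \sum_(L : rsubset n r)
     \det (submx_of A^T hI (rsubset_card L)) *
     col_det (submx_of B (rsubset_card L) hJ) * (\det A) ^+ s
  = (\det A) ^+ s *
    col_det (submx_of (A^T *m B + H *+ s) hI hJ + Q_col H hI hJ).
Proof.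
have AA i j k l : GRing.comm (A i j) (A k l) by apply/subr0_eq/hAA.
have AH i j k l : GRing.comm (A i j) (H k l) by apply/subr0_eq/hAH.
have AB i j k l : A i j * B k l = B k l * A i j - (if i == k then H j l else 0).
  by rewrite -hAB addrC subrK.
rewrite -mulr_suml (sum_minors _ AA) (capelli AA AB AH); apply: col_det_conj => a b.
have detXH : GRing.comm (\det A ^+ s) (H (elt hI a) (elt hJ b) *+ (r - b.+1)).
  by apply/commrMn/commr_sym/commrX/commr_sym/comm_det_H.
have -> : (submx_of (A^T *m B + H *+ s) hI hJ + Q_col H hI hJ) a b =
    (A^T *m B) (elt hI a) (elt hJ b) + H (elt hI a) (elt hJ b) *+ s
    + H (elt hI a) (elt hJ b) *+ (r - b.+1) by rewrite !mxE mulmxnE.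
by rewrite [in LHS]mxE mulrDl -detXH (ATB_detX AA AB AH) -mulrDr.
Qed.
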